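(* Let $\mathcal{B}\in\mathcal{A}^q$ be a non-empty system and let $w=\begin{bmatrix}u\\ y\end{bmatrix}$ be an input-output partition of $\mathcal{B}$, where $u(t)\in\mathbb{R}^m$ is an input and $y(t)\in\mathbb{R}^p$ is an output, with $p=q-m$. Let $n\in\mathbb{N}$ and let $A\in\mathbb{R}^{n\times n}$, $B\in\mathbb{R}^{n\times m}$, $C\in\mathbb{R}^{p\times n}$, $D\in\mathbb{R}^{p\times m}$. Then $$\mathcal{B}=\left\{w=\begin{bmatrix}u\\ y\end{bmatrix}\ \middle|\ \exists\, x\in(\mathbb{R}^n)^{\mathbb{Z}}:\ \sigma x=Ax+Bu+E,\ \ y=Cx+Du+F\right\}$$ for some $E\in\mathbb{R}^n$ and $F\in\mathbb{R}^p$ if and only if $$\mathcal{B}_{\mathrm{dif}}=\left\{w=\begin{bmatrix}u\\ y\end{bmatrix}\ \middle|\ \exists\, x\in(\mathbb{R}^n)^{\mathbb{Z}}:\ \sigma x=Ax+Bu,\ \ y=Cx+Du\right\}.$$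
   Context: A system (behavior) is a subset $\mathcal{B}\subseteq(\mathbb{R}^q)^{\mathbb{Z}}$. The shift is $(\sigma w)(t)=w(t+1)$. $\mathcal{B}$ is affine if $v,w\in\mathcal{B}$, $\alpha\in\mathbb{R}$ imply $\alpha v+(1-\alpha)w\in\mathcal{B}$; time-invariant if $\sigma\mathcal{B}=\mathcal{B}$; complete if $w\in\mathcal{B}$ holds if and only if $w|_{[t_0,t_1]}\in\mathcal{B}|_{[t_0,t_1]}$ for all integers $t_0<t_1$, where $\mathcal{B}|_{[t_0,t_1]}$ is the set of restrictions of elements of $\mathcal{B}$ to $[t_0,t_1]$. $\mathcal{A}^q$ is the class of all complete affine time-invariant systems in $(\mathbb{R}^q)^{\mathbb{Z}}$. The difference system is $\mathcal{B}_{\mathrm{dif}}:=\mathcal{B}-\mathcal{B}=\{a-b\mid a,b\in\mathcal{B}\}$. Vectors $E,F$ in the equations are identified with constant sequences. $\mathbb{N}$ denotes the positive integers. For a partition $w=\begin{bmatrix}u\\ y\end{bmatrix}$ with $u(t)\in\mathbb{R}^m$, $y(t)\in\mathbb{R}^p$: $u$ is free for $\mathcal{B}$ if for every sequence $u\in(\mathbb{R}^m)^{\mathbb{Z}}$ there is $y$ with $\begin{bmatrix}u\\ y\end{bmatrix}\in\mathcal{B}$; it is maximally free if it is free and none of the components of $y$ can be chosen freely in addition (for no component $y_i$ of $y$ is $(u,y_i)$ free). If $u$ is maximally free, $u$ is called an input, $y$ an output, and the partition an input-output partition. *)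

(* Defs.v *)
From mathcomp Require Import all_boot all_order all_algebra.
From mathcomp Require Import boolp classical_sets functions set_interval reals.

Set Implicit Arguments.
Unset Strict Implicit.
Unset Printing Implicit Defensive.

Import Order.TTheory GRing.Theory Num.Theory.

Local Open Scope classical_set_scope.
Local Open Scope ring_scope.

Notation signal R q := (int -> 'cV[R]_q).
Notation system R q := (set (int -> 'cV[R]_q)).

Definition shift (R : realType) (q : nat) (w : signal R q) : signal R q :=
  fun t => w (t + 1).

Definition affine_system (R : realType) (q : nat) (Sys : system R q) : Prop :=
  forall (v w : signal R q) (a : R),
    Sys v -> Sys w -> Sys (a *: v + (1 - a) *: w).

Definition time_invariant (R : realType) (q : nat) (Sys : system R q) : Prop :=
  @shift R q @` Sys = Sys.

Definition restriction (R : realType) (q : nat) (t0 t1 : int)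
    (w : signal R q) : `[t0, t1]%classic -> 'cV[R]_q :=
  sigL `[t0, t1]%classic w.
Arguments restriction {R q} t0 t1 w _.

Definition complete_system (R : realType) (q : nat) (Sys : system R q) : Prop :=
  forall w : signal R q,
    Sys w <-> (forall t0 t1 : int, t0 < t1 ->
      (restriction t0 t1 @` Sys) (restriction t0 t1 w)).

Definition affine_class (R : realType) (q : nat) : set (system R q) :=
  [set Sys | [/\ complete_system Sys, affine_system Sys & time_invariant Sys]].

Definition difference_system (R : realType) (q : nat) (Sys : system R q)
    : system R q :=
  [set a - b | a in Sys & b in Sys].

Definition io_signal (R : realType) (m p : nat)
    (u : signal R m) (y : signal R p) : signal R (m + p) :=
  fun t => col_mx (u t) (y t).

Definition input_free (R : realType) (m p : nat) (Sys : system R (m + p))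
    : Prop :=
  forall u : signal R m, exists y : signal R p, Sys (io_signal u y).

(* Freeness of (u, y_i): both u and the scalar sequence y_i can be prescribed
   arbitrarily, the other components of y being then found in the system. *)
Definition input_output_free (R : realType) (m p : nat)
    (Sys : system R (m + p)) (i : 'I_p) : Prop :=
  forall (u : signal R m) (f : int -> R), exists y : signal R p,
    Sys (io_signal u y) /\ (forall t, y t i 0 = f t).

Definition maximally_free (R : realType) (m p : nat) (Sys : system R (m + p))
    : Prop :=
  input_free Sys /\ (forall i : 'I_p, ~ input_output_free Sys i).

Definition io_partition (R : realType) (m p : nat) (Sys : system R (m + p))
    : Prop := maximally_free Sys.

Definition affine_state_space (R : realType) (m p n : nat)
    (A : 'M[R]_n) (B : 'M[R]_(n, m)) (C : 'M[R]_(p, n)) (D : 'M[R]_(p, m))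
    (E : 'cV[R]_n) (F : 'cV[R]_p) : system R (m + p) :=
  [set w | exists (u : signal R m) (y : signal R p),
    w = io_signal u y /\
    exists x : signal R n, forall t : int,
      shift x t = A *m x t + B *m u t + E /\
      y t = C *m x t + D *m u t + F].

Definition linear_state_space (R : realType) (m p n : nat)
    (A : 'M[R]_n) (B : 'M[R]_(n, m)) (C : 'M[R]_(p, n)) (D : 'M[R]_(p, m))
    : system R (m + p) :=
  [set w | exists (u : signal R m) (y : signal R p),
    w = io_signal u y /\
    exists x : signal R n, forall t : int,
      shift x t = A *m x t + B *m u t /\
      y t = C *m x t + D *m u t].

(* Main.v *)
Require Import Defs.
From mathcomp Require Import all_boot all_order all_algebra.
From mathcomp Require Import boolp classical_sets functions set_interval reals.

(** Fix a trajectory [w0 = (u0, y0)] of the system, so that the system is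
    [w0] plus its difference system. If the latter has the given linear
    state-space representation then, by time invariance, the increment
    [shift w0 - w0] has a linear state trajectory [x]. Let [z] be an
    antidifference of [x]. Then [shift z - A z - B u0] and [y0 - C z - D u0] have
    zero increments, hence are constants [E] and [F], so that [z] is a state
    trajectory of [w0] for the affine equations. Trajectories of the affine
    equations differ by trajectories of the linear ones. *)

Import Order.TTheory GRing.Theory Num.Theory.

Local Open Scope classical_set_scope.
Local Open Scope ring_scope.

Lemma signal_antidifference (R : realType) (q : nat) (x : signal R q) :
  exists z : signal R q, forall t, z (t + 1) = z t + x t.
Proof.
(* Normalised by value 0 at time 0: sums of [x] forward from 0, negated sums backward from -1. The
   two branches meet at [Negz 0], hence its own case below. *)
exists (fun t => match t with
  | Posz k => \sum_(i < k) x i%:Z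
  | Negz k => - \sum_(i < k.+1) x (Negz i)
  end) => -[k|[|k]].
- by rewrite -PoszD addn1 big_ord_recr.
- by rewrite /= big_ord0 big_ord_recr big_ord0 /= add0r addNr.
- have -> : Negz k.+1 + 1 = Negz k by rewrite !NegzE -addn1 PoszD opprD addrNK.
  by rewrite [in RHS]big_ord_recr /= opprD addrNK.
Qed.

Lemma signal_constant (R : realType) (q : nat) (g : signal R q) :
  (forall t, g (t + 1) = g t) -> forall t, g t = g 0.
Proof.
move=> gS; elim/int_rect=> // k IH; first by rewrite intS addrC gS.
by rewrite -[LHS]gS intS opprD addrAC addNr add0r.
Qed.

Lemma io_signalB (R : realType) (m p : nat) (u u' : signal R m)
    (y y' : signal R p) :
  io_signal u y - io_signal u' y' = io_signal (u - u') (y - y').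
Proof.
apply/funext => t; rewrite !fctE /io_signal.
by rewrite opp_col_mx add_col_mx.
Qed.

Lemma io_signalD (R : realType) (m p : nat) (u u' : signal R m)
    (y y' : signal R p) :
  io_signal u y + io_signal u' y' = io_signal (u + u') (y + y').
Proof. by apply/funext => t; rewrite !fctE /io_signal add_col_mx. Qed.

Lemma io_signal_surj (R : realType) (m p : nat) (w : signal R (m + p)) :
  exists (u : signal R m) (y : signal R p), w = io_signal u y.
Proof.
exists (usubmx \o w), (dsubmx \o w).
by apply/funext => t; rewrite /io_signal /= vsubmxK.
Qed.

Lemma io_signal_inj (R : realType) (m p : nat) (u u' : signal R m)
    (y y' : signal R p) :
  io_signal u y = io_signal u' y' -> u = u' /\ y = y'.
Proof.
move=> e; have H t := eq_col_mx (congr1 (@^~ t) e).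
by split; apply/funext => t; case: (H t).
Qed.

(** The signal is the reflection of [b] in the midpoint of [a] and [c]: two successive two-point
    affine combinations, with weights 1/2 and then 2. *)
Lemma affine_system_subD (R : realType) (q : nat) (Sys : system R q)
    (a b c : signal R q) :
  affine_system Sys -> Sys a -> Sys b -> Sys c -> Sys (a - b + c).
Proof.
move=> Saff Sa Sb Sc.
have -> : a - b + c = 2%:R *: (2%:R^-1 *: a + (1 - 2%:R^-1) *: c)
                      + (1 - 2%:R) *: b.
  rewrite scalerDr !scalerA mulrBr mulr1 divff ?pnatr_eq0 //.
  have -> : 2%:R - 1 = 1 :> R by rewrite -[X in X - _]natr1 addrK.
  have -> : 1 - 2%:R = -1 :> R by rewrite -[X in _ - X]nat1r opprD addNKr.
  by rewrite !scale1r scaleN1r addrAC.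
exact: Saff _ _ _ (Saff _ _ _ Sa Sc) Sb.
Qed.

Lemma linear_state_spaceD (R : realType) (m p n : nat)
    (A : 'M[R]_n) (B : 'M[R]_(n, m)) (C : 'M[R]_(p, n)) (D : 'M[R]_(p, m))
    (E : 'cV[R]_n) (F : 'cV[R]_p) (v w : signal R (m + p)) :
  linear_state_space A B C D v -> affine_state_space A B C D E F w ->
  affine_state_space A B C D E F (v + w).
Proof.
move=> [u [y [-> [x Hx]]]] [u' [y' [-> [x' Hx']]]].
exists (u + u'), (y + y'); rewrite io_signalD; split=> //.
exists (x + x') => t; move: (Hx t) (Hx' t); rewrite /shift !fctE.
by move=> [-> ->] [-> ->]; rewrite !mulmxDr; split;
  rewrite [LHS]addrA; congr (_ + _); rewrite addrACA.
Qed.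

Lemma affine_state_spaceB (R : realType) (m p n : nat)
    (A : 'M[R]_n) (B : 'M[R]_(n, m)) (C : 'M[R]_(p, n)) (D : 'M[R]_(p, m))
    (E : 'cV[R]_n) (F : 'cV[R]_p) (v w : signal R (m + p)) :
  affine_state_space A B C D E F v -> affine_state_space A B C D E F w ->
  linear_state_space A B C D (v - w).
Proof.
move=> [u [y [-> [x Hx]]]] [u' [y' [-> [x' Hx']]]].
exists (u - u'), (y - y'); rewrite io_signalB; split=> //.
exists (x - x') => t; move: (Hx t) (Hx' t); rewrite /shift !fctE.
by move=> [-> ->] [-> ->]; rewrite !mulmxBr; split;
  rewrite opprD [LHS]addrACA subrr addr0 opprD addrACA.
Qed.

Lemma affine_state_space_of_increment (R : realType) (m p n : nat)
    (A : 'M[R]_n) (B : 'M[R]_(n, m)) (C : 'M[R]_(p, n)) (D : 'M[R]_(p, m))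
    (w : signal R (m + p)) :
  linear_state_space A B C D (shift w - w) ->
  exists (E : 'cV[R]_n) (F : 'cV[R]_p), affine_state_space A B C D E F w.
Proof.
have [u0 [y0 ->]] := io_signal_surj _ _ _ w.
move=> [u [y [e [x Hx]]]].
(* The splitting of a signal into input and output is unique, so the trajectory [x] is driven by the
   increments of [u0]. *)
have {e}[eu ey] : shift u0 - u0 = u /\ shift y0 - y0 = y.
  by apply: io_signal_inj; rewrite -io_signalB -e.
have uS t : u0 (t + 1) = u0 t + u t.
  by rewrite -eu /shift !fctE [RHS]addrC subrK.
have yS t : y0 (t + 1) = y0 t + y t.
  by rewrite -ey /shift !fctE [RHS]addrC subrK.
have [z zS] := signal_antidifference _ _ x.
pose e t := z (t + 1) - (A *m z t + B *m u0 t).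
pose f t := y0 t - (C *m z t + D *m u0 t).
(* The increment of [e] at [t] is [x (t + 1) - (A *m x t + B *m u t)], which vanishes by the state
   equation; likewise the output equation annihilates that of [f]. *)
have eS : forall t, e t = e 0.
  apply: signal_constant => t; have [xS _] := Hx t.
  rewrite /e [z (t + 1 + 1)]zS [x (t + 1)]xS [in A *m z _]zS uS !mulmxDr.
  by rewrite [X in _ - X]addrACA opprD addrACA subrr addr0.
have fS : forall t, f t = f 0.
  apply: signal_constant => t; have [_ yE] := Hx t.
  rewrite /f zS yS uS yE !mulmxDr.
  by rewrite [X in _ - X]addrACA opprD addrACA subrr addr0.
exists (e 0), (f 0), u0, y0; split=> //; exists z => t.
by rewrite -(eS t) -(fS t) /e /f /shift; split; rewrite [RHS]addrC subrK.
Qed.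

Theorem theorem6 (R : realType) (m p n : nat) (Sys : system R (m + p))
    (Sys_class : affine_class Sys) (Sys_nonempty : Sys !=set0)
    (Sys_io : io_partition Sys) (n_gt0 : (0 < n)%N)
    (A : 'M[R]_n) (B : 'M[R]_(n, m)) (C : 'M[R]_(p, n)) (D : 'M[R]_(p, m)) :
  (exists (E : 'cV[R]_n) (F : 'cV[R]_p), Sys = affine_state_space A B C D E F)
  <-> difference_system Sys = linear_state_space A B C D.
Proof.
case: Sys_class => _ Saff Sshift; case: Sys_nonempty => w0 Sw0; split.
  move=> [E [F eS]]; apply/seteqP; split=> [_ [a Sa [b Sb <-]] | w Lw].
    by move: Sa Sb; rewrite eS; exact: affine_state_spaceB.
  (* A linear trajectory [w] is realised as the difference of [w + w0] and [w0]. *)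
  exists (w + w0); last by exists w0 => //; rewrite addrK.
  by move: Sw0; rewrite eS; exact: linear_state_spaceD.
move=> dS.
have Ssw0 : Sys (shift w0) by rewrite -Sshift; exists w0.
have [|E [F Aw0]] := affine_state_space_of_increment R m p n A B C D w0.
  by rewrite -dS; exists (shift w0) => //; exists w0.
(* The constants obtained from [w0] alone serve every trajectory. *)
exists E, F; apply/seteqP; split=> w Hw.
  rewrite -[w](subrK w0); apply: linear_state_spaceD Aw0.
  by rewrite -dS; exists w => //; exists w0.
(* Here [w - w0] is some [a - b] in the difference system, where [b] may differ from [w0]; affinity
   of [Sys] then yields [w] as [a - b + w0]. *)
have := affine_state_spaceB _ _ _ _ _ _ _ _ _ _ _ _ Hw Aw0.
rewrite -dS => -[a Sa [b Sb e]].
by rewrite -[w](subrK w0) -e; apply: affine_system_subD.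
Qed.
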